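(* Let $\alpha>1$ be real and set $\delta=1/\alpha^{\alpha-1}$. The online greedy algorithm for the Online Generalized Assignment Problem (with discount parameter $\delta$) is $\alpha^\alpha$-competitive: for every instance, if $\widetilde x$ denotes the assignment produced by the algorithm, then $$\sum_e\Big(\sum_j \ell_{je}\widetilde x_{je}\Big)^\alpha+\sum_e\sum_j c_{je}\widetilde x_{je}\;\le\;\alpha^\alpha\cdot \mathrm{OPT},$$ where $\mathrm{OPT}$ is the minimum, over all $x=(x_{je})$ with $x_{je}\ge 0$ for all $j,e$ and $\sum_e x_{je}\ge 1$ for all $j$, of $\sum_e\big(\sum_j \ell_{je}x_{je}\big)^\alpha+\sum_e\sum_j c_{je}x_{je}$.
   Context: Online Generalized Assignment Problem: there are finitely many machines $e=1,\dots,m$ ($m\ge1$) and jobs $j=1,\dots,n$ arriving one by one in this order. When job $j$ arrives, the numbers $\ell_{je}>0$ (load added to machine $e$ per unit of job $j$ assigned to $e$) and $c_{je}\in[0,\infty]$ (assignment cost per unit of job $j$ assigned to $e$) are revealed for every $e$; for each $j$ at least one $c_{je}$ is finite, and the convention $0\cdot\infty=0$ is used. The algorithm must irrevocably choose $x_{je}\ge0$ for all $e$ with $\sum_e x_{je}=1$ (fractional assignment) upon the arrival of $j$. Online greedy algorithm: when job $j$ arrives, it continuously increases the variables $x_{je}$ for the machines $e$ that currently minimize $\delta\,\alpha\,\ell_{je}\big(\sum_{i\le j}\ell_{ie}x_{ie}\big)^{\alpha-1}+c_{je}$ (possibly at different rates so as to keep these quantities balanced), until $\sum_e x_{je}=1$.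 Formally, given the values $x_{ie}$ for $i<j$, the values $(x_{je})_e$ are the unique nonnegative numbers with $\sum_e x_{je}=1$ such that whenever $x_{je}>0$, $$\delta\,\alpha\,\ell_{je}\Big(\sum_{i\le j}\ell_{ie}x_{ie}\Big)^{\alpha-1}+c_{je}\le \delta\,\alpha\,\ell_{je'}\Big(\sum_{i\le j}\ell_{ie'}x_{ie'}\Big)^{\alpha-1}+c_{je'}\quad\text{for every machine } e'.$$ *)

(* Defs.v *)
From mathcomp Require Import all_boot all_order all_algebra.
From mathcomp Require Import all_classical all_reals all_analysis.

Set Implicit Arguments.
Unset Strict Implicit.
Unset Printing Implicit Defensive.

Import Order.TTheory GRing.Theory Num.Theory.
Local Open Scope classical_set_scope.
Local Open Scope ring_scope.
Local Open Scope ereal_scope.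

Section GeneralizedAssignment.
Context {R : realType} {n m : nat}.

(** Jobs are ['I_n], in order of arrival; machines are ['I_m].  Assignment costs
    live in [\bar R], where [0 * +oo = 0]; all other data are real. *)
Implicit Types (alpha delta : R) (l : 'I_n -> 'I_m -> R)
  (c : 'I_n -> 'I_m -> \bar R) (x : 'I_n -> 'I_m -> R).

Definition gap_instance l c : Prop :=
  [/\ forall j e, (0 < l j e)%R,
      forall j e, 0 <= c j e
    & forall j, exists e, c j e < +oo].

Definition load l x (e : 'I_m) : R := (\sum_(j < n) l j e * x j e)%R.

(** The load of [e] due to the jobs [0, ..., j], [j] included. *)
Definition load_upto l x (j : 'I_n) (e : 'I_m) : R :=
  (\sum_(i < n | (i <= j)%N) l i e * x i e)%R.

Definition gap_cost alpha l c x : \bar R :=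
  \sum_(e < m) (load l x e `^ alpha)%:E
  + \sum_(e < m) \sum_(j < n) c j e * (x j e)%:E.

Definition gap_feasible x : Prop :=
  (forall j e, (0 <= x j e)%R) /\ (forall j, (1 <= \sum_(e < m) x j e)%R).

Definition gap_opt alpha l c : \bar R :=
  ereal_inf [set gap_cost alpha l c x | x in [set x | gap_feasible x]].

Definition discounted_marginal alpha delta l c x (j : 'I_n) (e : 'I_m) : \bar R :=
  (delta * alpha * l j e * load_upto l x j e `^ (alpha - 1))%:E + c j e.

(** Row [j] of [x] is the response of the greedy algorithm to job [j], given
    rows [i < j]; no row [i > j] occurs in this condition. *)
Definition greedy_step alpha delta l c x (j : 'I_n) : Prop :=
  [/\ forall e, (0 <= x j e)%R,
      (\sum_(e < m) x j e = 1)%R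
    & forall e, (0 < x j e)%R ->
        forall e', discounted_marginal alpha delta l c x j e
                   <= discounted_marginal alpha delta l c x j e'].

Definition greedy_assignment alpha delta l c x : Prop :=
  forall j, greedy_step alpha delta l c x j.

End GeneralizedAssignment.

(* Main.v *)
(** Write [L_e] for the final load of machine [e] under greedy and [L_(j,e)] for
    its load after job [j].  Since greedy puts job [j] on machines of minimal
    marginal [D_(j,e)], no fractional assignment [y] of job [j] beats it:
    [\sum_e D_(j,e) x_(j,e) <= \sum_e D_(j,e) y_(j,e)].  Summed over [j], the left
    side is at least [delta * \sum_e L_e ^ alpha + cost x], by convexity, and the
    right side is at most
    [delta * alpha * \sum_e L_e ^ (alpha - 1) * load_e y + cost y], by
    monotonicity of the loads.  Young's inequality bounds the last sum by
    [(alpha - 1) / alpha ^ alpha * \sum_e L_e ^ alpha + \sum_e (load_e y) ^ alpha],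
    and [delta - (alpha - 1) / alpha ^ alpha = 1 / alpha ^ alpha]. *)
Require Import Defs.
From mathcomp Require Import all_boot all_order all_algebra.
From mathcomp Require Import all_classical all_reals all_analysis.
From mathcomp Require Import ring lra.

Import Order.TTheory GRing.Theory Num.Theory.
Local Open Scope ring_scope.

Lemma powR_young {R : realType} {alpha u v : R} :
  1 < alpha -> 0 <= u -> 0 <= v ->
  alpha * u `^ (alpha - 1) * v <= (alpha - 1) * u `^ alpha + v `^ alpha.
Proof.
move=> a1 u0 v0.
have a0 : 0 < alpha by lra.
have b0 : 0 < alpha - 1 by lra.
have /(_ (divr_gt0 a0 b0) a0) := @conjugate_powR R (u `^ (alpha - 1)) v
  (alpha / (alpha - 1)) alpha (powR_ge0 _ _) v0.
have -> : (alpha / (alpha - 1))^-1 + alpha^-1 = 1 by field; lra.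
move=> /(_ erefl).
rewrite -powRrM (_ : (alpha - 1) * (alpha / (alpha - 1)) = alpha); last first.
  by field; lra.
rewrite -(ler_pM2l a0) mulrA => /le_trans; apply.
rewrite le_eqVlt; apply/orP; left; apply/eqP; field; lra.
Qed.

Lemma powR_sum_le {R : realType} {alpha : R} {n : nat} {a : 'I_n -> R} :
  1 < alpha -> (forall i, 0 <= a i) ->
  (\sum_(i < n) a i) `^ alpha <=
  \sum_(j < n) alpha * (\sum_(i < n | (i <= j)%N) a i) `^ (alpha - 1) * a j.
Proof.
move=> a1; elim: n a => [|n IH] a age0.
  by rewrite !big_ord0 powR0 //; apply/eqP; lra.
rewrite [leRHS]big_ord_recr /=.
have -> : \sum_(i < n.+1 | (i <= n)%N) a i = \sum_(i < n.+1) a i.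
  by apply: eq_bigl => i; rewrite -ltnS ltn_ord.
have prefixE (j : 'I_n) : \sum_(i < n.+1 | (i <= j)%N) a i =
    \sum_(i < n | (i <= j)%N) a (widen_ord (leqnSn n) i).
  by rewrite big_mkcond big_ord_recr /= leqNgt ltn_ord addr0 -big_mkcond.
under [X in _ <= X + _]eq_bigr => j _ do rewrite prefixE.
have := IH (fun i => a (widen_ord (leqnSn n) i)) (fun i => age0 _).
set X := \sum_(j < n) alpha * _ * _ => IHa.
have S0 k (b : 'I_k -> R) : (forall i, 0 <= b i) -> 0 <= \sum_(i < k) b i.
  by move=> b0; exact: sumr_ge0.
have := powR_young a1 (S0 _ a age0)
  (S0 _ (fun i => a (widen_ord (leqnSn n) i)) (fun i => age0 _)).
have aE : a ord_max =
    \sum_(i < n.+1) a i - \sum_(i < n) a (widen_ord (leqnSn n) i).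
  by rewrite big_ord_recr /=; ring.
have SE := @mulr_powRB1 R _ alpha (S0 _ a age0) (lt_trans ltr01 a1).
rewrite aE; move: IHa SE; set s := \sum_(i < n.+1) a i.
set t := \sum_(i < n) a _ => IHa SE Y.
rewrite mulrBr -mulrA [s `^ _ * s]mulrC SE.
lra.
Qed.

Section Greedy.
Context {R : realType} {n m : nat}.
Implicit Types (alpha delta : R) (l x y : 'I_n -> 'I_m -> R)
  (c : 'I_n -> 'I_m -> \bar R).

Lemma load_ge0 {l x} (e : 'I_m) :
  (forall j e, 0 < l j e) -> (forall j e, 0 <= x j e) -> 0 <= load l x e.
Proof. by move=> l0 x0; apply: sumr_ge0 => j _; rewrite mulr_ge0 // ltW. Qed.

Lemma load_upto_ge0 {l x} (j : 'I_n) (e : 'I_m) :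
  (forall j e, 0 < l j e) -> (forall j e, 0 <= x j e) -> 0 <= load_upto l x j e.
Proof. by move=> l0 x0; apply: sumr_ge0 => i _; rewrite mulr_ge0 // ltW. Qed.

Lemma load_upto_le {l x} (j : 'I_n) (e : 'I_m) :
  (forall j e, 0 < l j e) -> (forall j e, 0 <= x j e) ->
  load_upto l x j e <= load l x e.
Proof.
move=> l0 x0; rewrite /load_upto big_mkcond; apply: ler_sum => i _.
by case: ifP => // _; rewrite mulr_ge0 // ltW.
Qed.

Lemma greedy_step_le {alpha delta l c x y} (j : 'I_n) :
  (forall e, 0 <= discounted_marginal alpha delta l c x j e)%E ->
  greedy_step alpha delta l c x j ->
  (forall e, 0 <= y j e) -> 1 <= \sum_e y j e ->
  (\sum_e discounted_marginal alpha delta l c x j e * (x j e)%:E <=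
   \sum_e discounted_marginal alpha delta l c x j e * (y j e)%:E)%E.
Proof.
move=> D0 [x0 x1 xmin] y0 y1.
have [e0 xe0] : exists e0, 0 < x j e0.
  apply: contrapT => /forallNP xN; move: x1; rewrite big1 ?ltr01//.
    by move/eqP; rewrite eq_sym oner_eq0.
  by move=> e _; apply/eqP; rewrite eq_le x0 andbT leNgt; apply/negP.
set D := discounted_marginal _ _ _ _ _ _ in D0 xmin *.
apply: (@le_trans _ _ (D e0)).
  rewrite -[leRHS]mule1 -x1 -sumEFin ge0_sume_distrr; last first.
    by move=> e _; rewrite lee_fin.
  apply: lee_sum => e _; have [xe|] := ltP 0 (x j e).
    by apply: lee_wpmul2r; rewrite ?lee_fin // xmin.
  by move=> xe; rewrite (_ : x j e = 0) ?mule0//; apply/eqP; rewrite eq_le x0 xe.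
apply: (@le_trans _ _ (\sum_e D e0 * (y j e)%:E)%E).
  rewrite -ge0_sume_distrr; last by move=> e _; rewrite lee_fin.
  by rewrite -[leLHS]mule1 sumEFin lee_wpmul2l// lee_fin.
by apply: lee_sum => e _; apply: lee_wpmul2r; rewrite ?lee_fin // xmin.
Qed.

Lemma sum_discounted_marginalM {alpha delta l c x y} :
  0 <= alpha -> 0 <= delta -> gap_instance l c ->
  (forall j e, 0 <= x j e) -> (forall j e, 0 <= y j e) ->
  (\sum_j \sum_e discounted_marginal alpha delta l c x j e * (y j e)%:E =
   (delta * \sum_e \sum_j
      alpha * load_upto l x j e `^ (alpha - 1) * (l j e * y j e))%:E +
   \sum_e \sum_j c j e * (y j e)%:E)%E.
Proof.
move=> a0 d0 [l0 c0 _] x0 y0; rewrite exchange_big mulr_sumr -sumEFin -big_split.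
apply: eq_bigr => e _; rewrite mulr_sumr -sumEFin -big_split.
apply: eq_bigr => j _ /=; rewrite /discounted_marginal ge0_muleDl//; last first.
  by rewrite lee_fin !mulr_ge0 ?powR_ge0// ltW.
by rewrite -EFinM; congr (_%:E + _)%E; ring.
Qed.

Lemma greedy_cost_le {alpha delta l c x y} :
  1 < alpha -> 0 <= delta -> gap_instance l c ->
  greedy_assignment alpha delta l c x -> gap_feasible y ->
  ((delta * \sum_e load l x e `^ alpha)%:E
     + \sum_e \sum_j c j e * (x j e)%:E <=
   (delta * \sum_e alpha * load l x e `^ (alpha - 1) * load l y e)%:E
     + \sum_e \sum_j c j e * (y j e)%:E)%E.
Proof.
move=> a1 d0 linst xg [y0 y1]; have [l0 c0 _] := linst.
have a0 : 0 <= alpha by lra.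
have x0 j e : 0 <= x j e by have [] := xg j.
have D0 j e : (0 <= discounted_marginal alpha delta l c x j e)%E.
  by rewrite adde_ge0// lee_fin !mulr_ge0 ?powR_ge0// ltW.
have : (\sum_j \sum_e discounted_marginal alpha delta l c x j e * (x j e)%:E <=
   \sum_j \sum_e discounted_marginal alpha delta l c x j e * (y j e)%:E)%E.
  by apply: lee_sum => j _; exact: greedy_step_le.
rewrite !sum_discounted_marginalM// => H.
apply: (le_trans _ (le_trans H _)); apply: leeD2r; rewrite lee_fin ler_wpM2l//.
  apply: ler_sum => e _; apply: powR_sum_le => // j.
  by rewrite mulr_ge0// ltW.
apply: ler_sum => e _; rewrite [in leRHS]/load mulr_sumr; apply: ler_sum => j _.
rewrite ler_wpM2r// ?mulr_ge0//; first exact/ltW.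
rewrite ler_wpM2l// ge0_ler_powR ?nnegrE ?load_ge0 ?load_upto_ge0//.
- by rewrite subr_ge0 ltW.
- exact: load_upto_le.
Qed.

End Greedy.

(* [powR_young] at [u = L / alpha]. *)
Lemma powR_young_discounted {R : realType} {alpha L v : R} :
  1 < alpha -> 0 <= L -> 0 <= v ->
  1 / alpha `^ (alpha - 1) * (alpha * L `^ (alpha - 1) * v) <=
  (alpha - 1) / alpha `^ alpha * L `^ alpha + v `^ alpha.
Proof.
move=> a1 L0 v0; have a0 : 0 < alpha by lra.
have u0 : 0 <= L / alpha by rewrite divr_ge0// ltW.
have P0 r : alpha `^ r != 0 by rewrite gt_eqF// powR_gt0.
have LE r : L `^ r = (L / alpha) `^ r * alpha `^ r.
  by rewrite -powRM ?(ltW a0)// divfK// gt_eqF.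
have Y := powR_young a1 u0 v0.
rewrite !LE [leLHS](_ : _ = alpha * (L / alpha) `^ (alpha - 1) * v); last first.
  by field; exact: P0.
apply: (le_trans Y); rewrite lerD2r le_eqVlt; apply/orP; left; apply/eqP.
by field; exact: P0.
Qed.

Theorem theorem2p4 (R : realType) (alpha : R) (halpha : 1 < alpha)
    (n m : nat) (hm : (1 <= m)%N)
    (l : 'I_n -> 'I_m -> R) (c : 'I_n -> 'I_m -> \bar R)
    (hinst : gap_instance l c)
    (x : 'I_n -> 'I_m -> R)
    (hx : greedy_assignment alpha (1 / alpha `^ (alpha - 1)) l c x) :
  (gap_cost alpha l c x <= (alpha `^ alpha)%:E * gap_opt alpha l c)%E.
Proof.
have a0 : 0 < alpha by lra.
have [l0 c0 _] := hinst.
have x0 j e : 0 <= x j e by have [] := hx j.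
have K0 : 0 < alpha `^ alpha by exact: powR_gt0.
have K1 : 1 <= alpha `^ alpha by rewrite -[leLHS](powRr0 alpha) ler_powR// ltW.
rewrite -lee_pdivrMl//; apply/ereal_infP => _ [y yf <-]; have [y0 _] := yf.
have d0 : 0 <= 1 / alpha `^ (alpha - 1) by rewrite divr_ge0 ?powR_ge0.
have := greedy_cost_le halpha d0 hinst hx yf.
rewrite /gap_cost !sumEFin.
set S := \sum_e load l x e `^ alpha; set T := \sum_e load l y e `^ alpha.
set Cx := (\sum_e \sum_j c j e * (x j e)%:E)%E.
set Cy := (\sum_e \sum_j c j e * (y j e)%:E)%E => H.
have Cx0 : (0 <= Cx)%E.
  by apply: sume_ge0 => e _; apply: sume_ge0 => j _; rewrite mule_ge0 ?lee_fin.
have S0 : 0 <= S by apply: sumr_ge0 => e _; exact: powR_ge0.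
set k := (alpha - 1) / alpha `^ alpha.
have Young : 1 / alpha `^ (alpha - 1) *
    (\sum_e alpha * load l x e `^ (alpha - 1) * load l y e) <= k * S + T.
  rewrite !mulr_sumr -big_split; apply: ler_sum => e _ /=.
  by apply: powR_young_discounted; rewrite ?load_ge0.
have dE : 1 / alpha `^ (alpha - 1) = k + (alpha `^ alpha)^-1.
  rewrite /k -(@mulr_powRB1 R alpha alpha (ltW a0) a0); field.
  by rewrite !gt_eqF ?powR_gt0.
have {H} := le_trans H (leeD2r Cy (_ : _%:E <= (k * S + T)%:E)%E).
rewrite lee_fin => /(_ Young) {Young}.
rewrite dE mulrDl !EFinD -!addeA leeD2lE// => H; apply: le_trans H.
rewrite ge0_muleDr ?lee_fin// -EFinM leeD2l//.
rewrite -[leRHS]mul1e lee_wpmul2r// lee_fin invf_le1//.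
Qed.
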